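(* Consider a time-varying graph whose footprint $G=(V,E)$ contains no black hole, in which in each round an adversary may remove at most one edge of $G$ provided the graph remains connected in every round. There is a deterministic algorithm for two agents, initially co-located at a node of $G$, such that within $O(|E|^2)$ rounds at least one of the agents explores $G$ (visits every node), where each agent uses only $O(\log n)$ bits of memory and each node's whiteboard has $O(\log n)$ bits.
   Context: A time-varying graph (TVG) is $\mathcal{G}=(V,E,\mathbb{T},\rho)$ with discrete rounds $\mathbb{T}=\mathbb{Z}^+$ and $\rho:E\times\mathbb{T}\to\{0,1\}$ indicating whether an edge is present in a round. Its footprint $G=(V,E)$ is an undirected, unweighted, connected graph with $n=|V|$ anonymous nodes; edges at a node $v$ of degree $\delta_v$ carry locally unique port numbers $0,\dots,\delta_v-1$. Each node has a whiteboard that visiting agents can read, write and erase. Agents have distinct IDs from $[1,n^c]$ ($c>1$ constant unknown to them), know their own ID, and have no knowledge of $n$ or the maximum degree. Execution is synchronous; in each round each agent performs Look (reads the whiteboard, sees co-located agents and their parameters, learns whether its previous move attempt succeeded), Compute (chooses a port, may write on the whiteboard), Move (attempts to traverse the port; succeeds iff the edge is present in that round, otherwise stays). An agent knows the degree of its current node and its entry port but cannot detect a missing incident edge except by trying to traverse it. *)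

(* Defs.v *)
From mathcomp Require Import all_boot.
Set Implicit Arguments. Unset Strict Implicit. Unset Printing Implicit Defensive.

(* Nodes are 'I_nv.  Node v has degree deg v; port p < deg v leads to
   nbr v p, where the edge carries port back v p. Values of nbr/back at
   invalid ports (p >= deg v) are irrelevant. *)
Record pgraph := PGraph {
  nv : nat;
  deg : 'I_nv -> nat;
  nbr : 'I_nv -> nat -> 'I_nv;
  back : 'I_nv -> nat -> nat }.

Definition wf_pgraph (G : pgraph) : Prop :=
  (forall (v : 'I_(nv G)) p, p < deg v ->
     [/\ back v p < deg (nbr v p),
         nbr (nbr v p) (back v p) = v &
         back (nbr v p) (back v p) = p]) /\
  (forall (v : 'I_(nv G)) p, p < deg v -> nbr v p <> v) /\
  (forall (v : 'I_(nv G)) p q, p < deg v -> q < deg v -> nbr v p = nbr v q -> p = q).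

Definition adj (G : pgraph) : rel 'I_(nv G) :=
  fun u w => [exists p : 'I_(deg u), nbr u p == w].
Arguments adj : clear implicits.

Definition pconnected (G : pgraph) : Prop :=
  forall u w : 'I_(nv G), connect (adj G) u w.

Definition edges (G : pgraph) : {set {set 'I_(nv G)}} :=
  [set e : {set 'I_(nv G)} |
     [exists u : 'I_(nv G), exists w : 'I_(nv G), adj G u w && (e == [set u; w])]].

Definition nedges (G : pgraph) : nat := #|edges G|.

(* rho e t : presence of (footprint) edge e in round t (rounds t >= 1). *)
Definition tvg (G : pgraph) := {set 'I_(nv G)} -> nat -> bool.

Definition present (G : pgraph) (rho : tvg G) (t : nat) : rel 'I_(nv G) :=
  fun u w => adj G u w && rho [set u; w] t.

Definition adversary_ok (G : pgraph) (rho : tvg G) : Prop :=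
  forall t, 0 < t ->
    #|[set e in edges G | ~~ rho e t]| <= 1 /\
    (forall u w, connect (present rho t) u w).

(* Agent memory and whiteboard contents are bit strings.  One round of an
   agent (Look + Compute): given its own memory, the whiteboard content of
   its node, the degree of the node, its entry port (None if it has not
   moved yet), whether its previous move attempt succeeded (None if no
   attempt was made), and the memory of the co-located agent (if any),
   it returns its new memory, the new whiteboard content, and the port to
   try to traverse (None = stay). *)
Record algorithm := Algorithm {
  init : nat -> seq bool;   (* initial memory, from the agent's ID *)
  act : seq bool -> seq bool -> nat -> option nat -> option bool ->
        option (seq bool) -> seq bool * seq bool * option nat }.

Record agent (V : Type) := Ag {
  apos : V; amem : seq bool; aentry : option nat; asucc : option bool }.

Record config (V : Type) := Cfg {
  ag1 : agent V; ag2 : agent V; wb : V -> seq bool }.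

Section Exec.
Variables (A : algorithm) (G : pgraph) (rho : tvg G).
Local Notation V := 'I_(nv G).

Definition compute_one (a b : agent V) (w : V -> seq bool) :
    agent V * (V -> seq bool) * option nat :=
  let other := if apos b == apos a then Some (amem b) else None in
  let: (s', w', m) :=
    act A (amem a) (w (apos a)) (deg (apos a)) (aentry a) (asucc a) other in
  (Ag (apos a) s' (aentry a) (asucc a),
   (fun v => if v == apos a then w' else w v), m).

Definition move_one (t : nat) (a : agent V) (m : option nat) : agent V :=
  match m with
  | Some p =>
      if p < deg (apos a) then
        if rho [set apos a; nbr (apos a) p] t
        then Ag (nbr (apos a) p) (amem a) (Some (back (apos a) p)) (Some true)
        else Ag (apos a) (amem a) (aentry a) (Some false)
      else Ag (apos a) (amem a) (aentry a) None
  | None => Ag (apos a) (amem a) (aentry a) None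
  end.

(* one synchronous round t; whiteboard access is sequential, the agent
   with the smaller ID performing Look+Compute first *)
Definition step (id1 id2 t : nat) (c : config V) : config V :=
  if id1 < id2 then
    let: (a1, w1, m1) := compute_one (ag1 c) (ag2 c) (wb c) in
    let: (a2, w2, m2) := compute_one (ag2 c) a1 w1 in
    Cfg (move_one t a1 m1) (move_one t a2 m2) w2
  else
    let: (a2, w2, m2) := compute_one (ag2 c) (ag1 c) (wb c) in
    let: (a1, w1, m1) := compute_one (ag1 c) a2 w2 in
    Cfg (move_one t a1 m1) (move_one t a2 m2) w1.

Fixpoint exec (v0 : V) (id1 id2 : nat) (t : nat) : config V :=
  match t with
  | 0 => Cfg (Ag v0 (init A id1) None None) (Ag v0 (init A id2) None None)
             (fun _ => [::])
  | t'.+1 => step id1 id2 t (exec v0 id1 id2 t')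
  end.

End Exec.

Definition explores (V : finType) (f : nat -> V) (T : nat) : Prop :=
  forall v : V, exists2 t, t <= T & f t = v.

Definition logbound (C n : nat) : nat := C * (trunc_log 2 n).+1.

(* Main.v *)
(* The agent that acts first in round 1, which it recognises by an empty
   whiteboard, becomes the walker: it performs a depth-first traversal and
   retries a missing port until it gets through.  The other one, the searcher,
   performs a sequence of numbered depth-first phases; it skips missing ports,
   and starts a new phase when it fails to backtrack, when a phase ends, or when
   it meets the walker with a move counter different from the one (the anchor)
   seen when the current phase was started.

   While the walker is stuck, its edge is the only missing one and is not a
   bridge.  Hence a phase during which the walker does not move never fails to
   backtrack and skips no other edge, so it reaches every node; this takes
   O(|E|) rounds.  Any other phase costs the walker a move, up to a factor of
   two, and the walker makes O(|E|) moves: O(|E|^2) rounds in total.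

   Phase numbers must stay small for ever, so the searcher has to halt.  If a
   phase that was started in the presence of the walker ends in its presence
   with the same counter, everything has been explored and the searcher halts.
   Otherwise the walker completes its traversal and then repeats it once,
   leaving the mark 2, on which the searcher halts. *)

Require Import Defs.
From mathcomp Require Import all_boot zify.
Set Implicit Arguments. Unset Strict Implicit. Unset Printing Implicit Defensive.

(** * Encoding of natural numbers as bit strings *)

(** Self-delimiting binary code, low bit first: [true] announces a bit and [false] ends the number,
    so that codes can be concatenated. *)
Fixpoint nat_code (fuel n : nat) : seq bool :=
  if fuel is f.+1 then
    if n == 0 then [:: false] else [:: true, odd n & nat_code f n./2]
  else [:: false].

Definition encode (l : seq nat) : seq bool :=
  flatten [seq nat_code n n | n <- l].

Fixpoint decode (s : seq bool) : seq nat :=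
  match s with
  | true :: b :: s' => if decode s' is n :: l then b + n.*2 :: l else [::]
  | false :: s' => 0 :: decode s'
  | _ => [::]
  end.

Lemma nat_codeK f n s : n <= f -> decode (nat_code f n ++ s) = n :: decode s.
Proof.
elim: f n => [|f IH] n; first by rewrite leqn0 => /eqP ->.
rewrite /=; case: eqP => [-> //|n0] le_nf /=.
by rewrite IH ?odd_double_half //; lia.
Qed.

Lemma encodeK : cancel encode decode.
Proof. by elim=> //= n l IH; rewrite /encode /= nat_codeK // -/(encode l) IH. Qed.

Lemma size_nat_code f n k : n < 2 ^ k -> size (nat_code f n) <= k.*2.+1.
Proof.
elim: f n k => [|f IH] n k //= lt_n; case: eqP => //= n0.
case: k lt_n => [|k]; first by rewrite expn0; lia.
rewrite expnS => lt_n; rewrite doubleS !ltnS; apply: IH; lia.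
Qed.

Lemma size_encode l k :
  all (fun n => n < 2 ^ k) l -> size (encode l) <= size l * k.*2.+1.
Proof.
elim: l => //= n l IH /andP[lt_n lt_l]; rewrite /encode /= size_cat mulSn.
by rewrite leq_add ?size_nat_code ?IH.
Qed.

Lemma size_encode_le6 l k :
  all (fun n => n < 2 ^ k) l -> size l <= 6 -> size (encode l) <= 6 * k.*2.+1.
Proof.
move=> /size_encode h le6; apply: leq_trans h _.
by rewrite leq_mul2r le6 orbT.
Qed.

Definition nat_of_opt (o : option nat) : nat := if o is Some q then q.+1 else 0.
Definition opt_of_nat (n : nat) : option nat := if n is q.+1 then Some q else None.

Lemma nat_of_optK : cancel nat_of_opt opt_of_nat.
Proof. by case. Qed.

(** * The algorithm *)

(* [dmark] is the number of the last traversal that reached the node, [dptr]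
   the next port to try, [dpar] the port back to the parent. *)
Record dnode := DNode { dmark : nat; dptr : nat; dpar : option nat }.

Definition code_board (w : dnode * dnode) : seq bool :=
  encode [:: dmark w.1; dptr w.1; nat_of_opt (dpar w.1);
             dmark w.2; dptr w.2; nat_of_opt (dpar w.2)].

(** The first component belongs to the walker, the second to the searcher. The default 0 of [nth]
    makes the empty initial whiteboard read as unmarked for both; traversals are numbered from 1. *)
Definition board_of (s : seq bool) : dnode * dnode :=
  let l := decode s in
  (DNode (nth 0 l 0) (nth 0 l 1) (opt_of_nat (nth 0 l 2)),
   DNode (nth 0 l 3) (nth 0 l 4) (opt_of_nat (nth 0 l 5))).

Lemma code_boardK : cancel code_board board_of.
Proof.
by move=> [[m1 p1 q1] [m2 p2 q2]]; rewrite /board_of encodeK /= !nat_of_optK.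
Qed.

(* The flag tells whether the pending move backtracks; the last argument of
   [Walker] counts its successful moves, that of [Searcher] is the value of
   this counter in whose presence the current phase was started. *)
Inductive mem :=
  | Fresh
  | Walker (ret : bool) (port pass moves : nat)
  | WalkerDone
  | Searcher (ret : bool) (port phase : nat) (anchor : option nat)
  | SearcherDone.

(** [Fresh] gets the empty string, which is the initial memory. *)
Definition code_mem (m : mem) : seq bool :=
  encode match m with
         | Fresh => [::]
         | Walker ret p k s => [:: 1; nat_of_bool ret; p; k; s]
         | WalkerDone => [:: 2]
         | Searcher ret p k an => [:: 3; nat_of_bool ret; p; k; nat_of_opt an]
         | SearcherDone => [:: 4]
         end.

Definition mem_of (s : seq bool) : mem :=
  match decode s with
  | [:: 1; ret; p; k; s] => Walker (ret != 0) p k s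
  | [:: 2] => WalkerDone
  | [:: 3; ret; p; k; an] => Searcher (ret != 0) p k (opt_of_nat an)
  | [:: 4] => SearcherDone
  | _ => Fresh
  end.

Lemma code_memK : cancel code_mem mem_of.
Proof.
by case=> [|[] p k s||[] p k an|]; rewrite /mem_of encodeK //= nat_of_optK.
Qed.

Definition pending_port (m : mem) : option nat :=
  match m with Walker _ p _ _ | Searcher _ p _ _ => Some p | _ => None end.

(* The next move, as a backtracking flag and a port; [None] when the root is
   exhausted. *)
Definition scan (d : dnode) (dg : nat) : option (bool * nat) :=
  if dptr d < dg then Some (false, dptr d) else omap (pair true) (dpar d).

(** Coming back to a parent and failing on a forward port have the same effect: the pointer of the
    current node advances. *)
Definition visit (k : nat) (ret ok : bool) (q : nat) (d : dnode) (dg : nat) :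
    dnode * option (bool * nat) :=
  if ok && ~~ ret then
    if dmark d == k then (d, Some (true, q))
    else let d' := DNode k 0 (Some q) in (d', scan d' dg)
  else let d' := DNode (dmark d) (dptr d).+1 (dpar d) in (d', scan d' dg).

Definition walk (ret : bool) (p k s : nat) (w : dnode * dnode) (dg q : nat)
    (ok : bool) : mem * (dnode * dnode) :=
  if ok then
    let: (d, r) := visit k ret true q w.1 dg in
    if r is Some (ret', p') then (Walker ret' p' k s.+1, (d, w.2))
    else if k == 1 then (Walker false 0 2 s.+1, (DNode 2 0 None, w.2))
    else (WalkerDone, (d, w.2))
  else (Walker ret p k s, w).

(** When the root is exhausted, a counter that is met equals the anchor, since a different one has
    already caused a restart. *)
Definition search (ret : bool) (k : nat) (an : option nat)
    (w : dnode * dnode) (dg q : nat) (ok : bool) (met : option nat) :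
    mem * (dnode * dnode) :=
  if dmark w.1 == 2 then (SearcherDone, w) else
  let restart := (Searcher false 0 k.+1 met, (w.1, DNode k.+1 0 None)) in
  if (met != None) && (met != an) || ret && ~~ ok then restart else
  let: (d, r) := visit k ret ok q w.2 dg in
  if r is Some (ret', p') then (Searcher ret' p' k an, (w.1, d))
  else if met is Some _ then (SearcherDone, (w.1, d)) else restart.

Lemma visit_port k ret (ok : bool) q q' d dg : (ok -> q = q') ->
  visit k ret ok q d dg = visit k ret ok q' d dg.
Proof. by rewrite /visit; case: ok => //= ->. Qed.

Lemma walk_port ret p k s w dg q q' (ok : bool) : (ok -> q = q') ->
  walk ret p k s w dg q ok = walk ret p k s w dg q' ok.
Proof. by rewrite /walk; case: ok => //= ->. Qed.

Lemma search_port ret k an w dg q q' (ok : bool) met : (ok -> q = q') ->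
  search ret k an w dg q ok met = search ret k an w dg q' ok met.
Proof. by move=> e; rewrite /search (visit_port _ _ _ _ e). Qed.

Definition moves_of (m : mem) : option nat :=
  if m is Walker _ _ _ s then Some s else None.

(** The searcher starts beside a walker whose counter is 0, hence the anchor [Some 0]. *)
Definition decide (m : mem) (w : dnode * dnode) (dg : nat)
    (entry : option nat) (succ : option bool) (other : option mem) :
    mem * (dnode * dnode) :=
  let q := odflt 0 entry in
  let ok := succ == Some true in
  match m with
  | Fresh => if dmark w.1 == 0 then (Walker false 0 1 0, (DNode 1 0 None, w.2))
             else (Searcher false 0 1 (Some 0), (w.1, DNode 1 0 None))
  | Walker ret p k s => walk ret p k s w dg q ok
  | Searcher ret p k an => search ret k an w dg q ok (obind moves_of other)
  | _ => (m, w)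
  end.

Definition explorer : algorithm :=
  Algorithm (fun _ => [::])
    (fun s b dg entry succ other =>
       let: (m, w) :=
         decide (mem_of s) (board_of b) dg entry succ (omap mem_of other) in
       (code_mem m, code_board w, pending_port m)).

(** * Depth-first traversal *)

Section Traversal.
Variable G : pgraph.
Hypothesis wfG : wf_pgraph G.
Local Notation V := 'I_(nv G).
Implicit Types (D : V -> dnode) (T S : V -> nat -> Prop) (x y u v : V).

Definition update D y d : V -> dnode := fun v => if v == y then d else D v.

Lemma updateE D y d : update D y d y = d.
Proof. by rewrite /update eqxx. Qed.

Lemma update_neq D y d v : v != y -> update D y d v = D v.
Proof. by rewrite /update => /negbTE ->. Qed.

Lemma update_id D y : update D y (D y) =1 D.
Proof. by move=> v; rewrite /update; case: eqP => [->|]. Qed.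

Definition board_ok D : Prop := forall v,
  dptr (D v) <= deg v /\ (forall q, dpar (D v) = Some q -> q < deg v).

(** The stack is stored nowhere: it is the path of parent ports from [x] to the root, and the
    pointer of each ancestor still shows the port by which the path descends. *)
Fixpoint chain D T x (st : seq V) : Prop :=
  if st is u :: st' then
    (exists q, [/\ dpar (D x) = Some q, q < deg x, nbr x q = u,
                   back x q = dptr (D u) & T x q]) /\ chain D T u st'
  else dpar (D x) = None.

(** The usual depth-first invariant: [x :: st] are the grey nodes, and the other nodes of mark [k]
    are black. *)
Record stacked k D T S x (st : seq V) : Prop := Stacked {
  st_uniq : uniq (x :: st);
  st_mark : forall v, v \in x :: st -> dmark (D v) = k;
  st_chain : chain D T x st;
  st_done : forall v, dmark (D v) = k -> v \notin x :: st -> dptr (D v) = deg v;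
  st_closed : forall v p, dmark (D v) = k -> p < dptr (D v) -> p < deg v ->
    dmark (D (nbr v p)) = k \/ S v p }.

Definition scanning k D T S x : Prop :=
  (exists st, stacked k D T S x st) /\ board_ok D.

(* The situation between Compute and Move: the agent at [x] is about to try port
   [p], backtracking if [ret]; [st] lists the nodes on the path to the root that
   remain open.  [T] holds at the ports towards parents and [S] at the ports
   that have been skipped. *)
Definition pending k D T S (ret : bool) x p : Prop :=
  [/\ board_ok D, p < deg x &
  if ret then
    [/\ dmark (D x) = k, T x p, back x p = dptr (D (nbr x p)) &
        exists st, stacked k D T S (nbr x p) st]
  else p = dptr (D x) /\ exists st, stacked k D T S x st].

Definition closed_mark k D S : Prop := forall v p,
  dmark (D v) = k -> p < deg v -> dmark (D (nbr v p)) = k \/ S v p.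

Lemma chain_mono D D' T T' x st : (forall v p, T v p -> T' v p) ->
  dpar (D x) = dpar (D' x) -> {in st, forall v, D v = D' v} ->
  chain D T x st -> chain D' T' x st.
Proof.
move=> TT; elim: st x => [|u st IH] x /= ep eD; first by rewrite -ep.
case=> -[q [e1 e2 e3 e4 e5]] ch; split.
  by exists q; split; rewrite -?ep -?eD ?inE ?eqxx //; apply: TT.
apply: IH ch; first by rewrite eD ?inE ?eqxx.
by move=> v vst; apply: eD; rewrite inE vst orbT.
Qed.

Lemma stacked_mono k D T S T' S' x st :
  (forall v p, T v p -> T' v p) -> (forall v p, S v p -> S' v p) ->
  stacked k D T S x st -> stacked k D T' S' x st.
Proof.
move=> TT SS [h1 h2 h3 h4 h5]; split=> //; first exact: chain_mono h3.
by move=> v p m l1 l2; case: (h5 v p m l1 l2) => ?; [left | right; apply: SS].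
Qed.

(** For the searcher, [T] and [S] are implications from the walker being stuck; they only weaken
    from one round to the next. *)
Lemma pending_mono k D T S T' S' ret x p :
  (forall v p, T v p -> T' v p) -> (forall v p, S v p -> S' v p) ->
  pending k D T S ret x p -> pending k D T' S' ret x p.
Proof.
move=> TT SS [h1 h2 h3]; split=> //; case: ret h3.
  case=> e1 /TT e2 e3 [st h]; split=> //; exists st; exact: stacked_mono h.
by case=> e [st h]; split=> //; exists st; exact: stacked_mono h.
Qed.

Lemma pending_ext k D D' T S ret x p :
  D' =1 D -> pending k D T S ret x p -> pending k D' T S ret x p.
Proof.
move=> eD [h1 h2 h3]; split=> //; first by move=> v; rewrite eD.
have est z st : stacked k D T S z st -> stacked k D' T S z st.
  case=> g1 g2 g3 g4 g5; split=> //.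
  - by move=> v; rewrite eD; apply: g2.
  - by apply: chain_mono g3; rewrite ?eD // => v _; rewrite eD.
  - by move=> v; rewrite eD; apply: g4.
  - by move=> v q; rewrite !eD; apply: g5.
by case: ret h3 => [[e1 e2 e3]|[e1]] [st /est h]; rewrite !eD; do !split=> //; exists st.
Qed.

Lemma scan_pending k D T S x ret p :
  scanning k D T S x -> scan (D x) (deg x) = Some (ret, p) ->
  pending k D T S ret x p.
Proof.
case=> -[st hst] hD; rewrite /scan; case: ifP => [lt_p [<- <-]|].
  by split=> //; split=> //; exists st.
move=> ge_p; case Ep: (dpar (D x)) => [q|] //= [<- <-].
have lt_q : q < deg x by case: (hD x) => _; apply.
case: hst => h1 h2 h3 h4 h5; case: st => [|u st] in h1 h2 h3 h4 *.
  by move: h3 => /=; rewrite Ep.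
case: h3 => -[q' [e1 e2 e3 e4 e5]] ch.
have {e1} eq' : q' = q by move: e1; rewrite Ep => -[].
subst q' u; split=> //; split=> //; first by apply: h2; rewrite inE eqxx.
exists st; split=> //.
- by move: h1 => /= /andP[].
- by move=> v vst; apply: h2; rewrite inE vst orbT.
- move=> v mv vst; have [->|nvx] := eqVneq v x.
    by case: (hD x) => le_p _; lia.
  by apply: h4 => //; rewrite inE negb_or nvx.
Qed.

(** A current node without parent is alone on the stack, so every marked node is exhausted and
    [st_closed] covers all its ports. *)
Lemma scan_finished k D T S x :
  scanning k D T S x -> scan (D x) (deg x) = None ->
  [/\ dmark (D x) = k, dpar (D x) = None & closed_mark k D S].
Proof.
case=> -[st [h1 h2 h3 h4 h5]] hD; rewrite /scan; case: ifP => // ge_p.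
case Ep: (dpar (D x)) => [q|] //= _.
case: st => [|u st] in h1 h2 h3 h4 *; last first.
  by case: h3 => -[q' []]; rewrite Ep.
have mx : dmark (D x) = k by apply: h2; rewrite inE eqxx.
split=> // v p mv lt_p; apply: h5 => //.
have [evx|nvx] := eqVneq v x; last by rewrite h4 // inE.
by move: ge_p lt_p; rewrite evx; lia.
Qed.

Lemma pending_skip k D T S x p :
  pending k D T S false x p -> S x p ->
  scanning k (update D x (DNode (dmark (D x)) (dptr (D x)).+1 (dpar (D x)))) T S x.
Proof.
case=> hD lt_p [ep [st [h1 h2 h3 h4 h5]]] Sp; split; last first.
  move=> v; rewrite /update; case: eqP => [->|_] //=.
  by case: (hD x) => ? ?; split=> //; lia.
have em v : dmark (update D x (DNode (dmark (D x)) (dptr (D x)).+1 (dpar (D x))) v)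
  = dmark (D v) by rewrite /update; case: eqP => [->|].
exists st; split=> //.
- by move=> v /h2; rewrite em.
- apply: chain_mono h3 => //; first by rewrite updateE.
  move=> v vst; rewrite update_neq //; apply: contraTneq vst => ->.
  by case/andP: h1.
- move=> v; rewrite em => mv vst; rewrite update_neq ?h4 //.
  by move: vst; rewrite inE negb_or => /andP[].
- move=> v p'; rewrite !em => mv lt1 lt2.
  have [evx|nvx] := eqVneq v x; last by apply: h5 => //; rewrite update_neq in lt1.
  subst v; rewrite updateE /= ltnS leq_eqVlt -ep in lt1.
  case/orP: lt1 => [/eqP ->|lt1]; first by right.
  by apply: h5 => //; rewrite -ep.
Qed.

Lemma pending_return k D T S x p (u := nbr x p) :
  pending k D T S true x p ->
  scanning k (update D u (DNode (dmark (D u)) (dptr (D u)).+1 (dpar (D u)))) T S u.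
Proof.
case=> hD lt_p [mx _ eb [st hst]]; have [b1 b2 b3] := (proj1 wfG) x p lt_p.
(* The port down to [x] is declared skipped for a moment, which reduces the return to
   [pending_skip]; the declaration is then dropped because [x] is marked. *)
have Pu : pending k D T (fun v p' => S v p' \/ (v = u /\ p' = back x p)) false u (back x p).
  split=> //; split=> //; exists st; apply: stacked_mono hst => // v q; exact: or_introl.
have [|[st' [h1 h2 h3 h4 h5]] hD'] := pending_skip Pu; first by right.
split=> //; exists st'; split=> // v q mv lt1 lt2.
case: (h5 v q mv lt1 lt2) => [|[|[-> ->]]]; [by left | by right | left].
by rewrite b2 /update; case: eqP => //= exu; rewrite -exu.
Qed.

(** A marked node is left at once through the entry port; this counts as backtracking, and the stack
    stays as it was. *)
Lemma pending_old k D T S x p :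
  pending k D T S false x p -> dmark (D (nbr x p)) = k ->
  T (nbr x p) (back x p) ->
  pending k D T S true (nbr x p) (back x p).
Proof.
case=> hD lt_p [ep [st hst]] my Ty; have [b1 b2 b3] := (proj1 wfG) x p lt_p.
by split=> //; rewrite b2 b3; split=> //; exists st.
Qed.

Lemma pending_new k D T S x p (y := nbr x p) :
  pending k D T S false x p -> dmark (D y) <> k -> T y (back x p) ->
  scanning k (update D y (DNode k 0 (Some (back x p)))) T S y.
Proof.
case=> hD lt_p [ep [st [h1 h2 h3 h4 h5]]] my Ty.
have [b1 b2 b3] := (proj1 wfG) x p lt_p.
have yst : y \notin x :: st by apply/negP => /h2.
split; last first.
  move=> v; rewrite /update; case: eqP => [->|_] //=.
  by split=> // q [<-].
have em v : dmark (D v) = k -> dmark (update D y (DNode k 0 (Some (back x p))) v) = k.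
  by rewrite /update; case: eqP.
exists (x :: st); split.
- by rewrite cons_uniq yst.
- by move=> v; rewrite inE => /predU1P[->|/h2/em //]; rewrite updateE.
- split.
    exists (back x p); rewrite updateE; split=> //.
    rewrite update_neq ?b3 //; apply: contraNneq yst => <-.
    by rewrite inE eqxx.
  apply: chain_mono h3 => // [|v vst]; rewrite update_neq //.
    by apply: contraNneq yst => <-; rewrite inE eqxx.
  by apply: contraNneq yst => <-; rewrite inE vst orbT.
- move=> v mv; rewrite inE negb_or => /andP[nvy vst].
  by move: mv; rewrite update_neq // => mv; apply: h4.
- move=> v q mv lt1 lt2; have [evy|nvy] := eqVneq v y.
    by rewrite evy updateE in lt1.
  rewrite update_neq // in mv; rewrite update_neq // in lt1.
  by case: (h5 v q mv lt1 lt2) => [/em|]; [left | right].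
Qed.

Lemma pending_start k D T S x :
  board_ok D -> (forall v, dmark (D v) <> k) -> 0 < deg x ->
  pending k (update D x (DNode k 0 None)) T S false x 0.
Proof.
move=> hD nk dx; split=> //.
  by move=> v; rewrite /update; case: eqP.
split; first by rewrite updateE.
exists [::]; split=> //=.
- by move=> v; rewrite inE => /eqP ->; rewrite updateE.
- by rewrite updateE.
- move=> v mv; rewrite inE => nvx; rewrite update_neq // in mv.
  by case: (nk v).
- move=> v p mv; have [->|nvx] := eqVneq v x; first by rewrite updateE.
  by rewrite update_neq // in mv; case: (nk v).
Qed.

(** A clock for one traversal. Opening a node adds 1, turning back at a marked node sets the flag,
    and advancing a pointer adds 2, of which the flag takes back at most 1. So each step gains at
    least 1, up to [budget]. *)
Definition potential k D (ret : bool) : nat :=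
  \sum_(v | dmark (D v) == k) (dptr (D v)).*2.+1 + ret.

Definition budget : nat := (\sum_(v : V) (deg v).*2.+1).+1.

Lemma eq_potential k D D' ret : D' =1 D -> potential k D' ret = potential k D ret.
Proof.
by move=> eD; congr (_ + _); apply: eq_big => [v|v _]; rewrite eD.
Qed.

Lemma potential_le k D ret : board_ok D -> potential k D ret <= budget.
Proof.
move=> hD; rewrite /potential /budget -addn1 leq_add ?leq_b1 //.
rewrite big_mkcond leq_sum // => v _; case: ifP => // _.
by case: (hD v); lia.
Qed.

Lemma potential_update k D ret x d :
  potential k (update D x d) ret +
    (if dmark (D x) == k then (dptr (D x)).*2.+1 else 0) =
  potential k D ret + (if dmark d == k then (dptr d).*2.+1 else 0).
Proof.
rewrite /potential !(big_mkcond (fun v => _ == k)) /=.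
rewrite (bigD1 x) //= [X in _ = X + _ + _](bigD1 x) //= updateE.
rewrite (eq_bigr (fun v => if dmark (D v) == k then (dptr (D v)).*2.+1 else 0)); first lia.
by move=> v nvx; rewrite update_neq.
Qed.

Lemma potential_ret k D ret : potential k D ret = potential k D false + ret.
Proof. by rewrite /potential addn0. Qed.

Lemma potential_start k D x :
  (forall v, dmark (D v) <> k) ->
  potential k (update D x (DNode k 0 None)) false = 1.
Proof.
move=> nk; have := potential_update k D false x (DNode k 0 None).
rewrite /= eqxx (negbTE (introN eqP (nk x))) addn0 => ->.
by rewrite /potential big_pred0 // => v; apply/eqP/nk.
Qed.

(** One traversal step, common to both agents. The two clauses on [dpar] ensure that no second root
    appears. *)
Lemma visit_sound k D T S ret ok x p (y := if ok then nbr x p else x)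
    (d := (visit k ret ok (back x p) (D y) (deg y)).1)
    (r := (visit k ret ok (back x p) (D y) (deg y)).2) (D' := update D y d) :
  pending k D T S ret x p ->
  (ok -> T (nbr x p) (back x p)) -> (~~ ok -> S x p /\ ~~ ret) ->
  [/\ dmark d = k, board_ok D',
      (dmark (D y) = k -> dpar d = dpar (D y)),
      (dmark (D y) <> k -> dpar d <> None) &
  if r is Some (ret', p') then
    pending k D' T S ret' y p' /\ potential k D ret < potential k D' ret'
  else dpar d = None /\ closed_mark k D' S ].
Proof.
move=> hP hT hS; have [hD lt_p _] := hP; have [b1 b2 b3] := (proj1 wfG) x p lt_p.
(* [adv] handles both cases in which a pointer advances: a skipped port and a return. *)
have adv z (b : bool) : let d' := DNode (dmark (D z)) (dptr (D z)).+1 (dpar (D z)) in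
  dmark (D z) = k -> scanning k (update D z d') T S z ->
  [/\ dmark d' = k, board_ok (update D z d'),
      (dmark (D z) = k -> dpar d' = dpar (D z)),
      (dmark (D z) <> k -> dpar d' <> None) &
  if scan d' (deg z) is Some (ret', p') then
    pending k (update D z d') T S ret' z p' /\ potential k D b < potential k (update D z d') ret'
  else dpar d' = None /\ closed_mark k (update D z d') S ].
  move=> d' mz hs; have hs2 := hs; case: (hs2) => _ hD'; split=> //.
  case Es: (scan d' (deg z)) => [[ret' p']|]; last first.
    have /(_ _)/= := scan_finished hs.
    by rewrite updateE Es => /(_ erefl)[].
  split; first by apply: scan_pending hs _; rewrite updateE.
  have := potential_update k D false z d'; rewrite /d' /= mz eqxx.
  rewrite (potential_ret _ D b) (potential_ret _ _ ret') -/d'.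
  by have := leq_b1 b; lia.
rewrite /D' /d /r /visit; case: (boolP ok) => ok_ /=; last first.
  have [Sx nret] := hS ok_; have eret : ret = false by case: (ret) nret.
  rewrite eret in hP *; rewrite /y (negbTE ok_).
  apply: (adv x false); last exact: pending_skip hP Sx.
  by case: hP => _ _ [_ [st [_ h _ _ _]]]; apply: h; rewrite inE eqxx.
rewrite /y ok_; have {}hT := hT ok_.
case: (boolP ret) => ret_ /=.
  rewrite ret_ in hP; apply: (adv _ true); last exact: pending_return hP.
  by case: hP => _ _ [_ _ _ [st [_ h _ _ _]]]; apply: h; rewrite inE eqxx.
rewrite (negbTE ret_) in hP *.
case: (eqVneq (dmark (D (nbr x p))) k) => [mk|/eqP nk] /=.
  have hP' := pending_old hP mk hT.
  split=> //; first by move=> v; rewrite update_id.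
  split; first by apply: pending_ext hP' => v; rewrite update_id.
  rewrite (eq_potential _ _ (update_id D _)).
  by rewrite (potential_ret _ _ true) addn1.
have hs := pending_new hP nk hT; split=> //; first by case: hs.
have dy : 0 < deg (nbr x p) by lia.
rewrite /scan /= dy /=; split.
  by apply: scan_pending hs _; rewrite updateE /scan /= dy.
have := potential_update k D false (nbr x p) (DNode k 0 (Some (back x p))).
by rewrite /= eqxx (negbTE (introN eqP nk)); lia.
Qed.

(** * The walker *)

Hypothesis connG : pconnected G.
Variable rho : tvg G.
Hypothesis rho_ok : adversary_ok rho.
Hypothesis deg_gt0 : forall v : V, 0 < deg v.

(** * Missing edges and connectivity *)

Definition edge v p : {set V} := [set v; nbr v p].

Definition target t v p : V := if rho (edge v p) t then nbr v p else v.

Lemma edge_in v p : p < deg v -> edge v p \in edges G.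
Proof.
move=> lt_p; rewrite inE; apply/existsP; exists v; apply/existsP; exists (nbr v p).
by rewrite eqxx andbT; apply/existsP; exists (Ordinal lt_p).
Qed.

Lemma edge_back v p : p < deg v -> edge (nbr v p) (back v p) = edge v p.
Proof. by case/(proj1 wfG) => _ e _; rewrite /edge e setUC. Qed.

Lemma missing_edge_unique t e e' : 0 < t -> e \in edges G -> e' \in edges G ->
  ~~ rho e t -> ~~ rho e' t -> e = e'.
Proof.
move=> t0 he he' me me'; have [/card_le1_eqP h _] := rho_ok t0.
by apply: (h e' e); rewrite in_set ?he ?he'.
Qed.

Lemma connect_all (e : rel V) (P : V -> Prop) x :
  (forall u v, connect e u v) -> P x -> (forall u v, e u v -> P u -> P v) ->
  forall v, P v.
Proof.
move=> ce Px eP v; have /connectP[st] := ce x v.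
elim: st x Px {ce} => [|y st IH] x Px /=; first by move=> _ ->.
by case/andP => /eP /(_ Px) Py; exact: IH.
Qed.

Lemma closed_mark_all k D x :
  dmark (D x) = k -> closed_mark k D (fun _ _ => False) ->
  forall v, dmark (D v) = k.
Proof.
move=> mx cl; apply: (@connect_all (adj G) _ x) => // u v.
by case/existsP=> p /eqP <- mu; case: (cl u p mu (ltn_ord p)).
Qed.

(* The edge that is missing in round [t] is not a bridge. *)
Lemma closed_mark_all_but k D x e t :
  0 < t -> ~~ rho e t -> dmark (D x) = k ->
  closed_mark k D (fun v p => edge v p = e) ->
  forall v, dmark (D v) = k.
Proof.
move=> t0 me mx cl; have [_ conn] := rho_ok t0.
apply: (@connect_all (present rho t) _ x) => // u v /andP[/existsP[p /eqP <-] pr] mu.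
case: (cl u p mu (ltn_ord p)) => // ee.
by move: me; rewrite -ee /edge pr.
Qed.

Definition visited (f : nat -> V) t v : Prop := exists2 t', t' <= t & f t' = v.

Lemma visited_mono f t t' v : t <= t' -> visited f t v -> visited f t' v.
Proof. by move=> le_t [i le_i <-]; exists i => //; apply: leq_trans le_t. Qed.

Variables fA fB : nat -> V.
Local Notation K := budget.

(** The walker skips nothing, so its [S] is empty. Each move raises the potential, and the first
    traversal takes at most [K] moves. A mark 2 certifies that the walker has already been
    everywhere. *)
Definition walker_inv t xA mA D : Prop :=
  match mA with
  | Walker ret p k s =>
      [/\ k = 1 \/ k = 2,
          pending k D (fun _ _ => True) (fun _ _ => False) ret xA p,
          s < k.-1 * K + potential k D ret,
          forall v, dmark (D v) <= k /\ (dmark (D v) = k -> visited fA t v) &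
          k = 2 -> forall v, visited fA t v]
  | WalkerDone =>
      [/\ board_ok D, forall v, dmark (D v) = 2 & forall v, visited fA t v]
  | _ => False
  end.

Lemma walker_step t xA ret p k s D dB (y := target t xA p)
    (ok := rho (edge xA p) t)
    (mw := walk ret p k s (D y, dB) (deg y) (back xA p) ok) :
  walker_inv t xA (Walker ret p k s) D -> fA t = y ->
  [/\ walker_inv t.+1 y mw.1 (update D y mw.2.1), mw.2.2 = dB &
      if mw.1 is Walker r' p' k' s' then
        if ok then s' = s.+1 else y = xA /\ (p' = p /\ s' = s)
      else mw.1 = WalkerDone].
Proof.
case=> hk hP hs hm h2 fy; have [hD lt_p _] := hP.
have vis_mono v : visited fA t v -> visited fA t.+1 v by exact: visited_mono.
rewrite /mw /walk /y /target -/ok; case: (boolP ok) => ok_; last first.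
  split=> //=; split=> //.
  - by apply: pending_ext hP => v; rewrite update_id.
  - by rewrite (eq_potential k ret (update_id D xA)).
  - by move=> v; rewrite update_id; case: (hm v) => ? h; split=> // /h /vis_mono.
  - by move=> /h2 h v; apply/vis_mono.
have ey : nbr xA p = y by rewrite /y /target -/ok ok_.
have := @visit_sound k D (fun _ _ => True) (fun _ _ => False) ret true xA p hP.
rewrite /= => /(_ (fun _ => I) (fun H => match notF H with end)).
case Ev : (visit _ _ _ _ _ _) => [d r] /= [md hD' _ _ hr].
have mD v : dmark (update D (nbr xA p) d v) <= k /\
    (dmark (update D (nbr xA p) d v) = k -> visited fA t.+1 v).
  rewrite /update; case: eqP => [->|_].
    by rewrite md; split=> // _; exists t => //; rewrite ey.
  by case: (hm v) => ? h; split=> // /h /vis_mono.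
case: r hr Ev => [[ret' p'] [hP' lt_phi]|[ep cl]] Ev /=.
  split=> //; split=> //; first by lia.
  by move=> /h2 h v; apply/vis_mono.
have all_k := closed_mark_all (etrans (congr1 dmark (updateE _ _ _)) md) cl.
have vis v : visited fA t.+1 v by apply: (mD v).2.
case: hk => ek; last first.
  by rewrite ek /=; split=> //; split=> // v; rewrite -ek.
rewrite ek /=; split=> //.
have h0 v : dmark (D v) <= 1 by case: (hm v); rewrite ek.
have n2 v : dmark (D v) <> 2 by have := h0 v; lia.
split=> //; first by right.
- exact: pending_start.
- rewrite potential_start // mul1n; have := potential_le k ret hD.
  by rewrite ek mul0n add0n in hs *; lia.
- move=> v; rewrite /update; case: eqP => //= _; split=> //.
  by have := h0 v; lia.
Qed.

(** * The searcher *)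

(* [s] is the current move counter of the walker and [sg] its value when the
   phase started: as long as they agree, the walker has been stuck at the same
   edge during the whole phase. *)
Record searcher_ok t xA pA s xB ret p k an D sg : Prop := SearcherOk {
  so_le : sg <= s;
  so_pos : 0 < k;
  so_phase : k <= sg.*2 + (an != None);
  so_anchor : an = None \/ an = Some sg;
  so_pending : pending k D (fun v q => s = sg -> edge v q <> edge xA pA)
                           (fun v q => s = sg -> edge v q = edge xA pA) ret xB p;
  so_time : t <= k.-1 * K + potential k D ret;
  so_root : s = sg -> an <> None -> forall v,
    dmark (D v) = k -> dpar (D v) = None -> v = xA;
  so_away : s = sg -> an = None -> dmark (D xA) <> k;
  so_mark : forall v, dmark (D v) <= k /\ (dmark (D v) = k -> visited fB t v) }.

(** A searcher that is still active implies an active walker: once the walker is done every node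
    bears mark 2, and the searcher reads it later in the same round. *)
Definition searcher_inv t xA mA xB mB D : Prop :=
  match mB with
  | Searcher ret p k an =>
      if mA is Walker _ pA _ s then
        exists sg, searcher_ok t xA pA s xB ret p k an D sg
      else False
  | SearcherDone => (forall v, visited fA t v) \/ (forall v, visited fB t v)
  | _ => False
  end.

Lemma searcher_restart t xA pA s y k D met :
  board_ok D -> t <= k * K -> k.+1 <= s.*2 + (met != None) ->
  (forall v, dmark (D v) <= k) -> fB t = y ->
  (if met is Some s' then s' = s /\ y = xA else y <> xA) ->
  searcher_ok t.+1 xA pA s y false 0 k.+1 met (update D y (DNode k.+1 0 None)) s.
Proof.
move=> hD ht hk hm fy hmet.
have nk v : dmark (D v) <> k.+1 by have := hm v; lia.
split=> //.
- by case: met hmet {hk} => [s' [-> _]|]; [right | left].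
- exact: pending_start.
- by rewrite potential_start //=; lia.
- move=> _ met0 v; have [-> _ _|nvy] := eqVneq v y.
    by case: met hmet met0 {hk} => [s' []|].
  by rewrite update_neq // => /nk.
- move=> _ met0; rewrite met0 in hmet; rewrite update_neq //.
  by apply/eqP => exy; apply: hmet.
- move=> v; rewrite /update; case: eqP => [->|_] /=.
    by split=> // _; exists t.
  by split=> [|/nk //]; have := hm v; lia.
Qed.

(** The bound [so_phase] allows two new phases per walker move. At an unchanged counter the only
    possible restart leads from an unanchored phase to an anchored one. *)
Lemma search_step t xA mA DA xA' mA' xB ret p k an dA D
    rA pA kA s
    (y := target t xB p) (ok := rho (edge xB p) t)
    (met := if xA' == y then moves_of mA' else None)
    (mw := search ret k an (dA, D y) (deg y) (back xB p) ok met) :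
  0 < t -> mA = Walker rA pA kA s ->
  xA' = target t xA pA -> pA < deg xA ->
  walker_inv t.+1 xA' mA' DA -> DA y = dA ->
  (if mA' is Walker r' p' k' s' then
     if rho (edge xA pA) t then s' = s.+1 else xA' = xA /\ (p' = pA /\ s' = s)
   else mA' = WalkerDone) ->
  fB t = y ->
  searcher_inv t xA mA xB (Searcher ret p k an) D ->
  [/\ searcher_inv t.+1 xA' mA' y mw.1 (update D y mw.2.2),
      mw.2.1 = dA, board_ok (update D y mw.2.2) &
      forall v, dmark (update D y mw.2.2 v) <=
        if mw.1 is Searcher _ _ k' _ then k' else k].
Proof.
move=> t0 -> exA lt_pA hA edA hmA fy [sg hso].
have [hsg k0 hk hanc hP ht hroot haway hm] := hso; have [hD lt_p _] := hP.
have mark_id v : dmark (update D y (D y) v) <= k by rewrite update_id; case: (hm v).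
rewrite /mw /search /=; case: eqP => [m2|n2].
  split=> //=; last by move=> v; rewrite update_id.
  (* A mark 2 rules out a walker still in its first traversal. *)
  left; case: mA' hA hmA {met mw} => //= [r' p' k' s'|] hA _; last by case: hA.
  case: hA => hk' _ _ hm' h2 v; apply: h2.
  by case: hk' => // ek; case: (hm' y); rewrite edA m2 ek.
case: mA' hA hmA @met mw => // [r' p' k' s'|]; last first.
  by case=> _ h2 _; rewrite -edA h2 in n2.
move=> hA hmA met mw.
have hs' : sg <= s' by case: ifP hmA => [_ ->|_ [_ [_ ->]]] //; exact: leqW.
have hphase : t <= k * K.
  have := potential_le k ret hD; case: (k) k0 ht => // k1 _ /=; lia.
have restart_ok : k.+1 <= s'.*2 + (met != None) ->
  searcher_ok t.+1 xA' p' s' y false 0 k.+1 met (update D y (DNode k.+1 0 None)) s'.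
  move=> hk'; apply: searcher_restart => //; first by move=> v; case: (hm v).
  by rewrite /met; case: eqP => //= n e; apply: n.
have bound_restart v : dmark (update D y (DNode k.+1 0 None) v) <= k.+1.
  by rewrite /update; case: eqP => //= _; case: (hm v); lia.
have board_restart : board_ok (update D y (DNode k.+1 0 None)).
  by move=> v; rewrite /update; case: eqP.
(* While the walker is stuck, its edge is the only missing one. *)
have stuck : s' = sg ->
  [/\ s = sg, ~~ rho (edge xA pA) t, xA' = xA & p' = pA].
  by case: ifP hmA => [_ ->|_ [-> [-> ->]]] //; lia.
have eAE : edge xA pA \in edges G by exact: edge_in.
have eBE : edge xB p \in edges G by exact: edge_in.
have present_neq : s' = sg -> ok -> edge xB p <> edge xA pA.
  by case/stuck => _ nA _ _ ok_ e; move: nA; rewrite -e -/ok ok_.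
have absent_eq : s' = sg -> ~~ ok -> edge xB p = edge xA pA.
  by case/stuck => _ nA _ _ nok; exact: (missing_edge_unique t0).
case: ifP => [abort|no_abort].
  split=> //; exists s'; apply: restart_ok.
  (* If the walker has moved, the bound grows by 2, enough even if the anchor is lost. If it is
     stuck, the restart gains an anchor; a failed backtrack is impossible, since parent edges differ
     from the only missing edge. *)
  case: (eqVneq s' sg) => [es'|]; last by have := leq_b1 (an != None); lia.
  have [es nA _ _] := stuck es'.
  case/orP: abort => [/andP[m1 m2]|/andP[ret_ nok]].
    rewrite m1; case: hanc => ean.
      by move: hk; rewrite ean es' /= addn0 addn1 ltnS.
    by move: m1 m2; rewrite /met ean; case: ifP => //= _ _; rewrite es' eqxx.
  case: hP => _ _; rewrite ret_ => -[_ hT _ _].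
  by case: (hT es); exact: absent_eq.
have {no_abort} [hmet hret] : (met = None \/ met = an) /\ (~~ ok -> ~~ ret).
  move/negbT: no_abort; rewrite negb_or !negb_and !negbK => /andP[h1 h2]; split.
    by case/orP: h1 => /eqP; [left | right].
  by move=> nok; move: h2; rewrite (negbTE nok) orbF.
have hP' : pending k D (fun v q => s' = sg -> edge v q <> edge xA' p')
                       (fun v q => s' = sg -> edge v q = edge xA' p') ret xB p.
  by apply: pending_mono hP => v q h e; case/stuck: (e) => e1 e2 -> ->; exact: h.
have := visit_sound (ok := ok) hP'; rewrite -/y.
have eyok : (if ok then nbr xB p else xB) = y by [].
rewrite eyok; case Ev: (visit _ _ _ _ _ _) => [d r] /= hv.
case: hv.
- by move=> ok_ e; rewrite edge_back //; case/stuck: (e) => _ _ -> ->; exact: present_neq.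
- move=> nok; split; last exact: hret.
  by move=> e; case/stuck: (e) => _ _ -> ->; exact: absent_eq.
move=> md hD' hpar1 hpar2 hr.
have mD v : dmark (update D y d v) <= k /\
    (dmark (update D y d v) = k -> visited fB t.+1 v).
  rewrite /update; case: eqP => [->|_].
    by rewrite md; split=> // _; exists t.
  by case: (hm v) => ? h; split=> // /h /(visited_mono (leqnSn _)).
have root v : s' = sg -> an <> None -> dmark (update D y d v) = k ->
    dpar (update D y d v) = None -> v = xA'.
  case/stuck => es _ -> _ an0; rewrite /update; case: eqP => [->|_]; last exact: hroot.
  move=> _ dp; case: (eqVneq (dmark (D y)) k) => [mk|/eqP nk].
    by apply: hroot => //; rewrite -hpar1.
  by case: (hpar2 nk).
have away : s' = sg -> met = None -> an = None -> dmark (update D y d xA') <> k.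
  move=> es' met0 an0; have [es _ -> _] := stuck es'.
  rewrite update_neq; first exact: haway.
  by move: met0; rewrite /met; case: eqP => // n _; apply/eqP; case/stuck: es' => _ _ <- _.
case: r Ev hr => [[ret' q] Ev [hP2 lt_phi]|Ev [ed cl]] /=.
  split=> //; last by move=> v; case: (mD v).
  exists sg; split=> //; first by lia.
  - by move=> es an0 v; apply: root.
  - move=> es an0; apply: away => //.
    by case: hmet => // ->.
(* A phase during which the walker was stuck has reached every node. *)
have full : s' = sg -> forall v, dmark (update D y d v) = k.
  move=> es'; have [_ nA ex ep] := stuck es'.
  apply: (closed_mark_all_but t0 nA (etrans (congr1 dmark (updateE _ _ _)) md)).
  by move=> v q mv lq; case: (cl v q mv lq) => [|h]; [left | right; rewrite h ?ex ?ep].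
case Em: met => [s1|] /=; last first.
  split=> //; exists s'; move: restart_ok; rewrite Em; apply.
  (* The walker must have moved: otherwise an unanchored phase would have marked the walker's node,
     and an anchored one would end at its root, where the walker stands. *)
  case: (eqVneq s' sg) => [es'|]; last by have := leq_b1 (an != None); lia.
  case: (an) hanc root away {hmet} => [a|] _ root away; last by case: (away es' Em erefl (full es' _)).
  have := root y es' _ (full es' _); rewrite updateE => /(_ _ ed) ey.
  by move: Em; rewrite /met -ey // eqxx.
split=> //; last by move=> v; case: (mD v).
(* Here [met], and hence the anchor, is the current counter: the walker was stuck during the whole
   phase and [full] applies. *)
right=> v; apply: (mD v).2; apply: full.
case: hmet; rewrite Em // => ean; case: hanc; rewrite -ean // => -[<-].
by move: Em; rewrite /met; case: ifP => //= _ [].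
Qed.

(** * Executions *)

Lemma compute_explorer (a b : agent V) (w : V -> seq bool) m d :
  decide (mem_of (amem a)) (board_of (w (apos a))) (deg (apos a)) (aentry a)
    (asucc a) (if apos b == apos a then Some (mem_of (amem b)) else None) = (m, d) ->
  compute_one explorer a b w =
    (Ag (apos a) (code_mem m) (aentry a) (asucc a),
     fun v => if v == apos a then code_board d else w v, pending_port m).
Proof. by move=> e; rewrite /compute_one /=; case: eqP e => _ /= ->. Qed.

Lemma move_port t x m e s p (a := move_one rho t (Ag x m e s) (Some p)) :
  p < deg x ->
  [/\ apos a = target t x p, amem a = m,
      (asucc a == Some true) = rho (edge x p) t &
      asucc a == Some true -> odflt 0 (aentry a) = back x p].
Proof. by rewrite /a /move_one /target /edge /= => ->; case: (rho _ t). Qed.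

(** An inequality, because the empty initial whiteboard decodes to zeros but is shorter than their
    code. *)
Definition board_spec (w : V -> seq bool) DA DB : Prop := forall v,
  board_of (w v) = (DA v, DB v) /\ size (w v) <= size (code_board (DA v, DB v)).

(* [xA] and [xB] are the positions before the Move part of round [t]. *)
Definition run_inv t (a b : agent V) (w : V -> seq bool) : Prop :=
  exists xA mA xB mB (DA DB : V -> dnode),
  [/\ exists e s, a = move_one rho t (Ag xA (code_mem mA) e s) (pending_port mA),
      exists e s, b = move_one rho t (Ag xB (code_mem mB) e s) (pending_port mB),
      board_spec w DA DB,
      walker_inv t xA mA DA &
      [/\ searcher_inv t xA mA xB mB DB, board_ok DB &
          forall v, dmark (DB v) <= 4 * K]].

(** The agents are ordered by role, the walker acting first; [exec_run] translates this into the
    order of IDs. *)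
Definition round t (c : agent V * agent V * (V -> seq bool)) :=
  let: (a, b, w) := c in
  let: (a1, w1, m1) := compute_one explorer a b w in
  let: (b1, w2, m2) := compute_one explorer b a1 w1 in
  (move_one rho t a1 m1, move_one rho t b1 m2, w2).

Lemma board_spec_fst w DA DB y d : board_spec w DA DB ->
  board_spec (fun v => if v == y then code_board (d, DB y) else w v)
             (update DA y d) DB.
Proof.
by move=> h v; rewrite /update; case: eqP => [->|_] //; rewrite code_boardK.
Qed.

Lemma board_spec_snd w DA DB y d : board_spec w DA DB ->
  board_spec (fun v => if v == y then code_board (DA y, d) else w v)
             DA (update DB y d).
Proof.
by move=> h v; rewrite /update; case: eqP => [->|_] //; rewrite code_boardK.
Qed.

Lemma walker_moves_lt t xA r p k s D :
  walker_inv t xA (Walker r p k s) D -> s < 2 * K.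
Proof.
case=> hk [hD _ _] hs _ _; have := potential_le k r hD.
by case: hk hs => -> /=; lia.
Qed.

Lemma searcher_phase_le t xA pA s xB r p k an D sg :
  searcher_ok t xA pA s xB r p k an D sg -> k <= s.*2.+1.
Proof. by case=> h _ hk _ _ _ _ _ _; have := leq_b1 (an != None); lia. Qed.

Lemma run_inv_first x :
  fA 0 = x -> fB 0 = x ->
  let c := round 1 (Ag x [::] None None, Ag x [::] None None, fun _ => [::]) in
  run_inv 1 c.1.1 c.1.2 c.2.
Proof.
move=> fAx fBx; pose D0 (_ : V) := DNode 0 0 None.
have spec0 : board_spec (fun _ => [::]) D0 D0 by [].
rewrite /round (@compute_explorer _ _ _ (Walker false 0 1 0) (DNode 1 0 None, D0 x)) //.
rewrite (@compute_explorer _ _ _ (Searcher false 0 1 (Some 0))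
  (DNode 1 0 None, DNode 1 0 None)); last by rewrite !eqxx code_boardK.
exists x, (Walker false 0 1 0), x, (Searcher false 0 1 (Some 0)).
exists (update D0 x (DNode 1 0 None)), (update D0 x (DNode 1 0 None)).
have ok0 : board_ok D0 by [].
have vis (f : nat -> V) : f 0 = x -> forall v, dmark (update D0 x (DNode 1 0 None) v) <= 1 /\
    (dmark (update D0 x (DNode 1 0 None) v) = 1 -> visited f 1 v).
  by move=> fx v; rewrite /update; case: eqP => [->|] //=; split=> // _; exists 0.
split; [by exists None, None | by exists None, None | | |].
- have h1 := board_spec_fst x (DNode 1 0 None) spec0.
  have := board_spec_snd x (DNode 1 0 None) h1.
  by rewrite updateE.
- split=> //; [by left | exact: pending_start | | exact: vis].
  by rewrite potential_start.
- split.
  (* Phase 1 counts as a restart after an empty phase 0. *)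
  + by exists 0; apply: searcher_restart.
  + by move=> v; rewrite /update; case: eqP.
  + by move=> v; case: (vis fB fBx v); rewrite /K; lia.
Qed.

Lemma run_inv_next t a b w :
  0 < t -> fA t = apos a -> fB t = apos b -> run_inv t a b w ->
  let c := round t.+1 (a, b, w) in run_inv t.+1 c.1.1 c.1.2 c.2.
Proof.
move=> t0 fAt fBt [xA [mA [xB [mB [DA [DB [[eA [sA ea]] [eB [sB eb]] hw hA [hB hDB hm]]]]]]]].
have [mA' [dA' [decA hA' hmA xA']]] : exists mA' dA',
  [/\ forall o, decide (mem_of (amem a)) (DA (apos a), DB (apos a)) (deg (apos a))
        (aentry a) (asucc a) o = (mA', (dA', DB (apos a))),
      walker_inv t.+1 (apos a) mA' (update DA (apos a) dA'),
      (if mA is Walker _ pA _ s then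
         if mA' is Walker r' p' k' s' then
           if rho (edge xA pA) t then s' = s.+1 else apos a = xA /\ (p' = pA /\ s' = s)
         else mA' = WalkerDone
       else mA' = WalkerDone) &
      if mA is Walker _ pA _ s then apos a = target t xA pA /\ pA < deg xA else True].
  case: mA ea hA {hB} => [|ret p k s| |ret p k an|] // ea hA.
    have lt_p : p < deg xA by case: hA => _ [].
    have [pa ma sa qa] := move_port t (code_mem (Walker ret p k s)) eA sA lt_p.
    rewrite -/(pending_port (Walker ret p k s)) -ea in pa ma sa qa.
    rewrite pa in fAt *; have [] := walker_step (DB (target t xA p)) hA fAt.
    case Ew: (walk _ _ _ _ _ _ _ _) => [m' [d' dB']] /= h1 h2 h3.
    exists m', d'; split=> // o.
    by rewrite ma code_memK /= sa (@walk_port _ _ _ _ _ _ _ (back xA p)) ?Ew ?h2 // -sa.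
  have pa : apos a = xA by rewrite ea.
  exists WalkerDone, (DA xA); split=> //; rewrite ?pa //; first by move=> o; rewrite ea /= code_memK.
  case: hA => h1 h2 h3; split=> [v|v|v]; rewrite ?update_id //.
  by apply: visited_mono (h3 v).
rewrite /round (@compute_explorer _ _ _ mA' (dA', DB (apos a))); last first.
  by rewrite (hw (apos a)).1.
have := board_spec_fst (apos a) dA' hw.
set w1 := fun v => _; move=> hw1.
set DA' := update DA (apos a) dA' in hA' hw1 *.
have [mB' [dB' [decB hB' hDB' hm']]] : exists mB' dB',
  [/\ decide (mem_of (amem b)) (DA' (apos b), DB (apos b)) (deg (apos b))
        (aentry b) (asucc b) (if apos a == apos b then Some mA' else None)
        = (mB', (DA' (apos b), dB')),
      searcher_inv t.+1 (apos a) mA' (apos b) mB' (update DB (apos b) dB'),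
      board_ok (update DB (apos b) dB') &
      forall v, dmark (update DB (apos b) dB' v) <= 4 * K].
  case: mB eb hB => [|ret p k s| |ret p k an|] // eb hB; last first.
    have mb : amem b = code_mem SearcherDone by rewrite eb.
    exists SearcherDone, (DB (apos b)); split=> //.
    - by rewrite mb code_memK.
    - move: hB => [] h; [left | right] => v; exact: visited_mono (h v).
    - by move=> v; rewrite update_id.
    - by move=> v; rewrite update_id.
  case: mA hA hB hmA xA' {ea} => // rA pA kA s hA hB hmA [xA' lt_pA].
  have hB2 := hB; case: hB2 => sg hso.
  have lt_p : p < deg xB by case: hso => _ _ _ _ [].
  have [pb mb sb qb] := move_port t (code_mem (Searcher ret p k an)) eB sB lt_p.
  rewrite -/(pending_port (Searcher ret p k an)) -eb in pb mb sb qb.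
  rewrite pb in fBt *.
  have [] := search_step t0 (erefl _) xA' lt_pA hA' (erefl _) hmA fBt hB.
  case Es: (search _ _ _ _ _ _ _ _) => [m' [d1 d']] /= h1 h2 h3 h4.
  exists m', d'; split=> //.
    rewrite mb code_memK /= sb (@search_port _ _ _ _ _ _ (back xB p)); last by rewrite -sb.
    by rewrite -h2 in Es *; rewrite -Es h2; case: (_ == _).
  (* A phase number is at most twice the counter plus one, and the counter is below [2 * K]. *)
  move=> v; apply: leq_trans (h4 v) _; have := walker_moves_lt hA.
  have := searcher_phase_le hso.
  case: m' h1 {Es h4} => //=; try lia.
  move=> rB pB k' anB; case: mA' hA' {hmA decA} => // r' p' k2 s' hA'.
  case=> sg' /searcher_phase_le; have := walker_moves_lt hA'; lia.
rewrite (@compute_explorer _ _ _ mB' (DA' (apos b), dB')); last first.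
  by rewrite (hw1 (apos b)).1 /= code_memK.
have := board_spec_snd (apos b) dB' hw1; set w2 := fun v => _; move=> hw2.
exists (apos a), mA', (apos b), mB', DA', (update DB (apos b) dB').
by split=> //; [exists (aentry a), (asucc a) | exists (aentry b), (asucc b)].
Qed.

Definition run x : nat -> agent V * agent V * (V -> seq bool) :=
  fix run t := if t is t'.+1 then round t (run t')
               else (Ag x [::] None None, Ag x [::] None None, fun _ => [::]).

Lemma runS x t : run x t.+1 = round t.+1 (run x t).
Proof. by []. Qed.

Lemma exec_run x id1 id2 t : id1 != id2 ->
  exec explorer rho x id1 id2 t =
    let: (a, b, w) := run x t in
    if id1 < id2 then Cfg a b w else Cfg b a w.
Proof.
move=> ne; elim: t => [|t IH] /=; first by case: ifP.
rewrite {}IH; case: (run x t) => [[a b] w]; rewrite /round /step.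
case: (id1 < id2) => /=.
  case: (compute_one explorer a b w) => [[a1 w1] m1].
  by case: (compute_one explorer b a1 w1) => [[b1 w2] m2].
case: (compute_one explorer a b w) => [[a1 w1] m1].
by case: (compute_one explorer b a1 w1) => [[b1 w2] m2].
Qed.

(** * Space and time bounds *)

Lemma deg_lt_budget v : deg v < K.
Proof. by rewrite /budget ltnS (bigD1 v) //=; lia. Qed.

Lemma size_code_board m DA DB v : 4 * K < 2 ^ m -> board_ok DA -> board_ok DB ->
  dmark (DA v) <= 2 -> dmark (DB v) <= 4 * K ->
  size (code_board (DA v, DB v)) <= 6 * m.*2.+1.
Proof.
move=> hm hA hB mA mB; apply: size_encode_le6 => //=.
have hK := deg_lt_budget v.
case: (hA v) (hB v) => h1 h2 [h3 h4].
have par D : (forall q, dpar (D v) = Some q -> q < deg v) -> nat_of_opt (dpar (D v)) <= deg v.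
  by case: (dpar (D v)) => //= q; apply.
have := par DA h2; have := par DB h4; lia.
Qed.

Lemma walker_board t xA mA D : walker_inv t xA mA D ->
  board_ok D /\ forall v, dmark (D v) <= 2.
Proof.
case: mA => //= [r p k s [hk [] hD _ _ _ hm _]|[h1 h2 _]].
  by split=> // v; case: (hm v); case: hk => ->; lia.
by split=> // v; rewrite h2.
Qed.

Lemma size_walker m t xA mA D : 4 * K < 2 ^ m -> walker_inv t xA mA D ->
  size (code_mem mA) <= 6 * m.*2.+1.
Proof.
move=> hm; case: mA => [|r p k s||? ? ? ?|] // h; last first.
  by rewrite /code_mem; apply: size_encode_le6 => //=; have : 0 < K by []; lia.
have := walker_moves_lt h; case: h => hk [_ lt_p _] _ _ _ lt_s.
rewrite /code_mem; apply: size_encode_le6 => //=.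
have := deg_lt_budget xA; have := leq_b1 r; by case: hk => ->; lia.
Qed.

Lemma size_searcher m t xA mA DA xB mB D :
  4 * K < 2 ^ m -> walker_inv t xA mA DA -> searcher_inv t xA mA xB mB D ->
  size (code_mem mB) <= 6 * m.*2.+1.
Proof.
move=> hm hA; case: mB => [|? ? ? ?||r p k an|] // hB; last first.
  by rewrite /code_mem; apply: size_encode_le6 => //=; have : 0 < K by []; lia.
case: mA hA hB => // rA pA kA s /walker_moves_lt lt_s [sg hso].
have := searcher_phase_le hso.
case: hso => le_sg _ _ hanc [_ lt_p _] _ _ _ _ le_k.
rewrite /code_mem; apply: size_encode_le6 => //=.
have := deg_lt_budget xB; have := leq_b1 r.
by case: hanc => -> /=; lia.
Qed.

Lemma run_inv_size t a b w m : 4 * K < 2 ^ m -> run_inv t a b w ->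
  [/\ size (amem a) <= 6 * m.*2.+1, size (amem b) <= 6 * m.*2.+1 &
      forall v, size (w v) <= 6 * m.*2.+1].
Proof.
move=> hm [xA [mA [xB [mB [DA [DB [[eA [sA ->]] [eB [sB ->]] hw hA [hB hDB hmB]]]]]]]].
have am x mem e s o : amem (move_one rho t (Ag x mem e s) o) = mem.
  by rewrite /move_one; case: o => //= p; case: (p < _) => //=; case: (rho _ t).
rewrite !am; split; [exact: size_walker hA | exact: (size_searcher hm hA hB) |].
move=> v; apply: leq_trans (hw v).2 _; have [hDA hmA] := walker_board hA.
exact: size_code_board.
Qed.

(** Otherwise the searcher is active and the walker is in its first traversal, with counter below
    [K]. Then there are fewer than [2 * K] phases of at most [K] rounds each, contradicting the
    round number. *)
Lemma run_inv_explored a b w :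
  run_inv ((2 * K).+1 * K).+1 a b w ->
  (forall v, visited fA ((2 * K).+1 * K).+1 v) \/
  (forall v, visited fB ((2 * K).+1 * K).+1 v).
Proof.
move=> [xA [mA [xB [mB [DA [DB [_ _ _ hA [hB hDB _]]]]]]]].
case: mB hB => //= r p k an; case: mA hA => // rA pA kA s hA [sg hso].
left; case: hA => hk [hD _ _] hs _ h2; apply: h2; case: hk => // ek.
have := searcher_phase_le hso; have := potential_le k r hDB; have := potential_le kA rA hD.
case: hso => _ k0 _ _ _ ht _ _ _; subst kA; rewrite /= mul0n add0n in hs.
move=> p1 p2 le_k; exfalso.
have lek : k <= (2 * K).+1 by lia.
have : k * K <= (2 * K).+1 * K by rewrite leq_mul2r lek orbT.
have : k.-1 * K + K = k * K by rewrite -mulSnr prednK.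
lia.
Qed.

End Traversal.

(** * Counting edges *)

Section Counting.
Variable G : pgraph.
Hypothesis wfG : wf_pgraph G.
Hypothesis connG : pconnected G.
Hypothesis nontrivial : 1 < nv G.
Local Notation V := 'I_(nv G).

Lemma connected_deg_gt0 (v : V) : 0 < deg v.
Proof.
have [u nuv] : exists u : V, u != v.
  have := ltn_ord v; case: (eqVneq (val v) 0) => e lt_v.
    by exists (Ordinal nontrivial); rewrite -val_eqE /= e.
  by exists (Ordinal (ltnW nontrivial)); rewrite -val_eqE /= eq_sym.
have /connectP[[|w st] /=] := connG v u; first by move=> _ e; rewrite e eqxx in nuv.
by case/andP=> /existsP[[p lt_p] _] _ _; apply: leq_trans lt_p.
Qed.

Lemma deg_le (v : V) : deg v <= nv G.
Proof.
rewrite -[X in _ <= X]card_ord -[X in X <= _]card_ord.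
apply: (@leq_card _ _ (fun p : 'I_(deg v) => nbr v p)) => p q e.
by apply: val_inj; apply: (proj2 (proj2 wfG)) e; apply: ltn_ord.
Qed.

(** Double counting of incidences: the ports of a node inject into the edges containing it, and an
    edge has at most two ends. *)
Lemma sum_deg_le : \sum_(v : V) deg v <= (nedges G).*2.
Proof.
have deg_edges (v : V) : deg v <= \sum_(e in edges G) (v \in e).
  rewrite -big_mkcondr sum1_card -[X in X <= _]card_ord.
  rewrite -(@card_in_imset _ _ (fun p : 'I_(deg v) => edge v p) predT).
    apply/subset_leq_card/subsetP => _ /imsetP[p _ ->].
    by rewrite unfold_in /= edge_in //= !inE eqxx.
  move=> p q _ _ /setP e; apply: val_inj; apply: (proj2 (proj2 wfG)) => //=.
  have := e (nbr v p); rewrite !inE eqxx orbT => /esym/orP[] /eqP //.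
  by have /(_ (ltn_ord p)) := (proj1 (proj2 wfG)) v p.
apply: (@leq_trans (\sum_(v : V) \sum_(e in edges G) (v \in e))).
  by apply: leq_sum => v _; exact: deg_edges.
rewrite exchange_big /= /nedges -muln2 -sum_nat_const leq_sum // => e.
rewrite inE => /existsP[u /existsP[w /andP[_ /eqP ->]]].
rewrite -big_mkcond sum1_card cards2; by case: (u != w).
Qed.

Lemma budget_edges : budget G <= 6 * nedges G + 1.
Proof.
(* Degrees are positive, so the constant 1 is absorbed into a third copy of the degree. *)
have : \sum_(v : V) (deg v).*2.+1 <= \sum_(v : V) 3 * deg v.
  by apply: leq_sum => v _; have := connected_deg_gt0 v; lia.
rewrite -big_distrr /budget /= => h.
by have := leq_trans h (leq_mul (leqnn 3) sum_deg_le); lia.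
Qed.

Lemma budget_nodes : budget G <= 4 * nv G ^ 2.
Proof.
have : \sum_(v : V) (deg v).*2.+1 <= \sum_(v : V) (nv G).*2.+1.
  by apply: leq_sum => v _; have := deg_le v; lia.
rewrite sum_nat_const card_ord /budget; nia.
Qed.

End Counting.

Theorem theorem10 :
  exists A : algorithm,
    forall c : nat, 1 < c ->
    exists C : nat,
      forall (G : pgraph) (rho : tvg G) (v0 : 'I_(nv G)) (id1 id2 : nat),
        wf_pgraph G -> pconnected G -> adversary_ok rho ->
        0 < id1 <= nv G ^ c -> 0 < id2 <= nv G ^ c -> id1 != id2 ->
        let ex := exec A rho v0 id1 id2 in
        (forall t,
           size (amem (ag1 (ex t))) <= logbound C (nv G) /\
           size (amem (ag2 (ex t))) <= logbound C (nv G) /\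
           (forall v, size (wb (ex t) v) <= logbound C (nv G))) /\
        exists2 T, T <= C * (nedges G) ^ 2 + C &
          (explores (fun t => apos (ag1 (ex t))) T \/
           explores (fun t => apos (ag2 (ex t))) T).
Proof.
(* A generous constant: the strings have at most 24 L + 90 bits, with L the logarithm, and the time
   is at most 72 E^2 + 30 E + 4, with E the number of edges. *)
exists explorer => c _; exists 200 => G rho v0 id1 id2 wfG connG rho_ok id1P id2P ne ex.
(* A single node would leave only one possible ID. *)
have n1 : 1 < nv G.
  rewrite ltn_neqAle (leq_ltn_trans (leq0n _) (ltn_ord v0)) andbT.
  by apply/eqP => e; move: id1P id2P ne; rewrite -e exp1n; lia.
have deg0 := connected_deg_gt0 connG n1.
pose fA t := apos (run rho v0 t).1.1; pose fB t := apos (run rho v0 t).1.2.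
have inv t : let c := run rho v0 t.+1 in run_inv rho fA fB t.+1 c.1.1 c.1.2 c.2.
  elim: t => [|t]; first exact: (@run_inv_first G rho deg0 fA fB v0).
  rewrite [run _ _ t.+2]runS; have fAt : fA t.+1 = apos (run rho v0 t.+1).1.1 by [].
  have fBt : fB t.+1 = apos (run rho v0 t.+1).1.2 by [].
  case: (run rho v0 t.+1) fAt fBt => [[a b] w] fAt fBt.
  exact: (run_inv_next wfG connG rho_ok deg0 (ltn0Sn t) fAt fBt).
set L := trunc_log 2 (nv G).
have lt_n : nv G < 2 ^ L.+1 by apply: trunc_log_ltn.
(* By [budget_nodes] the left side is at most 16 n^2, and n is below [2 ^ L.+1]. *)
have ltK : 4 * budget G < 2 ^ (L.*2 + 7).
  have := budget_nodes wfG n1.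
  have -> : 2 ^ (L.*2 + 7) = 32 * (2 ^ L.+1) ^ 2.
    by rewrite -expnM (_ : L.*2 + 7 = 5 + L.+1 * 2) ?expnD //; lia.
  move: (2 ^ L.+1) lt_n => x lt_n; nia.
have small : 6 * (L.*2 + 7).*2.+1 <= logbound 200 (nv G).
  by rewrite /logbound -/L; lia.
split.
  move=> t; rewrite /ex exec_run //; case: t => [|t]; first by rewrite /=; case: ifP.
  have := inv t; case: (run rho v0 t.+1) => [[a b] w].
  case/(run_inv_size ltK) => sa sb sw.
  by case: ifP => _ /=; do !split; try move=> v; apply: (leq_trans _ small).
exists ((2 * budget G).+1 * budget G).+1.
  have hK := budget_edges wfG connG n1; have := leq_mul hK hK.
  move: (budget G) (nedges G) hK => K E; nia.
have := inv ((2 * budget G).+1 * budget G).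
case Er: (run _ _ _) => [[a b] w] /run_inv_explored.
have pos t : (apos (ag1 (ex t)), apos (ag2 (ex t))) =
    if id1 < id2 then (fA t, fB t) else (fB t, fA t).
  rewrite /ex exec_run // /fA /fB; case: (run rho v0 t) => [[? ?] ?].
  by case: ifP.
have vis f g T : (forall t, g t = f t) -> (forall v, visited f T v) -> explores g T.
  by move=> eg h v; case: (h v) => i le_i <-; exists i.
case: (id1 < id2) pos => pos [] h.
- by left; apply: vis h => t; case: (pos t).
- by right; apply: vis h => t; case: (pos t).
- by right; apply: vis h => t; case: (pos t).
- by left; apply: vis h => t; case: (pos t).
Qed.
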